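(* Let $G$ be a finite simple connected graph with at least two vertices. Then $o(G\circ K_2)\in\{\mathcal{R},\mathcal{S}\}$. Moreover: if $G$ has true twins, then $S_{\rm MB}(G\circ K_2)=S_{\rm MB}'(G\circ K_2)=2$; if $G$ has no true twins, then $R_{\rm MB}(G\circ K_2)=R_{\rm MB}'(G\circ K_2)=n(G)$.
   Context: $n(G)$ is the number of vertices of $G$; $K_2$ is the complete graph on two vertices. Vertices $u\neq v$ are twins if $N(u)\setminus\{v\}=N(v)\setminus\{u\}$ (open neighborhoods); adjacent twins are true twins. The lexicographic product $G\circ H$ has vertex set $V(G)\times V(H)$, with $(g,h)(g',h')$ an edge iff $gg'\in E(G)$, or $g=g'$ and $hh'\in E(H)$. A set $W\subseteq V(X)$ is a resolving set of a connected graph $X$ if for every two distinct vertices $x,y$ there is $z\in W$ with $d(x,z)\ne d(y,z)$. In the Maker-Breaker resolving game on $X$, Resolver and Spoiler alternately select unplayed vertices of $X$; Resolver wins if the vertices he selects contain a resolving set of $X$, and Spoiler wins if she selects at least one vertex of every resolving set of $X$. The R-game has Resolver moving first; the S-game has Spoiler moving first. The outcome $o(X)$ is $\mathcal{R}$ if Resolver has a winning strategy no matter who starts, $\mathcal{S}$ if Spoiler has a winning strategy no matter who starts, and $\mathcal{N}$ if the first player has a winning strategy. $R_{\rm MB}(X)$ (resp. $R_{\rm MB}'(X)$) is the minimum number of moves Resolver needs to win the R-game (resp. S-game) under optimal play; $S_{\rm MB}(X)$ (resp. $S_{\rm MB}'(X)$) is the minimum number of moves Spoiler needs to win the R-game (resp.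 S-game) under optimal play. *)

(* Defs.v *)
From HB Require Import structures.
From mathcomp Require Import all_boot.
Set Implicit Arguments.
Unset Strict Implicit.
Unset Printing Implicit Defensive.

Record sgraph := SGraph {
  vertex :> finType;
  edge : rel vertex;
  edge_sym : symmetric edge;
  edge_irr : irreflexive edge }.
Arguments edge {s}.

Definition connected (G : sgraph) := forall x y : G, connect edge x y.

Definition nbh (G : sgraph) (u : G) : {set G} := [set w | edge u w].

Definition twins (G : sgraph) (u v : G) :=
  u <> v /\ nbh u :\ v = nbh v :\ u.

Definition true_twins (G : sgraph) (u v : G) := twins u v /\ edge u v.

Definition has_true_twins (G : sgraph) := exists u v : G, true_twins u v.

Section CompleteGraph.
Variable n : nat.
Definition complete_rel : rel 'I_n := [rel i j | i != j].
Fact complete_sym : symmetric complete_rel.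
Proof. by move=> i j; rewrite /complete_rel /= eq_sym. Qed.
Fact complete_irr : irreflexive complete_rel.
Proof. by move=> i; rewrite /complete_rel /= eqxx. Qed.
Definition complete_graph := SGraph complete_sym complete_irr.
End CompleteGraph.

Definition K2 := complete_graph 2.

Section LexProduct.
Variables G H : sgraph.
Definition lex_rel : rel (G * H)%type :=
  [rel x y | edge x.1 y.1 || (x.1 == y.1) && edge x.2 y.2].
Fact lex_sym : symmetric lex_rel.
Proof.
by move=> x y; rewrite /lex_rel /= edge_sym eq_sym [edge x.2 _]edge_sym.
Qed.
Fact lex_irr : irreflexive lex_rel.
Proof. by move=> x; rewrite /lex_rel /= !edge_irr andbF. Qed.
Definition lex_prod := SGraph lex_sym lex_irr.
End LexProduct.

(* Length of a shortest walk from x to y; a shortest walk has fewer than #|X|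
   edges, so the search bound is harmless when x and y are connected (and the
   junk value #|X| is returned when they are not). *)
Definition dist (X : sgraph) (x y : X) : nat :=
  find (fun k => [exists p : k.-tuple X, path edge x p && (last x p == y)])
       (iota 0 #|X|).

Definition resolving (X : sgraph) (W : {set X}) :=
  forall x y : X, x <> y -> exists2 z, z \in W & dist x z <> dist y z.

Variant player := Resolver | Spoiler.

Definition opponent p := if p is Resolver then Spoiler else Resolver.

Definition is_resolver p := if p is Resolver then true else false.
Definition player_of_bool (b : bool) := if b then Resolver else Spoiler.
Fact is_resolverK : cancel is_resolver player_of_bool. Proof. by case. Qed.
HB.instance Definition _ := Equality.copy player (can_type is_resolverK).

Section Game.
Variable X : sgraph.

(* A history lists the selected vertices in the order of their selection; the
   players alternate, so the player selecting its i-th entry is determined by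
   the player moving first. *)
Definition mover (first : player) (i : nat) : player :=
  if odd i then opponent first else first.

Definition selected (p first : player) (h : seq X) : seq X :=
  mask [seq mover first i == p | i <- iota 0 (size h)] h.

Definition wins (p : player) (W : {set X}) : Prop :=
  match p with
  | Resolver => exists2 R : {set X}, resolving R & R \subset W
  | Spoiler => forall R : {set X}, resolving R -> exists2 x, x \in R & x \in W
  end.

Definition strategy := seq X -> X.

Definition legal (s : strategy) :=
  forall h : seq X, uniq h -> size h < #|X| -> s h \notin h.

Definition follows (p first : player) (s : strategy) (h : seq X) :=
  forall (h1 : seq X) (x : X) (h2 : seq X),
    h = h1 ++ x :: h2 -> mover first (size h1) = p -> x = s h1.

(* Plays are continued until every vertex is selected. This is harmless: [wins]
   is monotone in W and the two players cannot both win, so a win obtained at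
   an earlier stage persists. *)
Definition complete_play (h : seq X) := uniq h /\ size h = #|X|.

Definition winning_strategy (p first : player) (s : strategy) :=
  legal s /\
  forall h, complete_play h -> follows p first s h ->
    wins p [set x in selected p first h].

Definition has_winning_strategy (p first : player) :=
  exists s, winning_strategy p first s.

(* [p] can force having won by the time of his or her k-th move. *)
Definition can_win_within (p first : player) (k : nat) :=
  exists s, legal s /\
  forall h, complete_play h -> follows p first s h ->
    wins p [set x in take k (selected p first h)].

Definition min_moves (p first : player) (k : nat) :=
  can_win_within p first k /\
  forall j, can_win_within p first j -> k <= j.

Fact min_moves_unique p first k l :
  min_moves p first k -> min_moves p first l -> k = l.
Proof.
by case=> kw km [lw lm]; apply/eqP; rewrite eqn_leq km //= lm.
Qed.

End Game.

Variant outcome := OutcomeR | OutcomeS | OutcomeN.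

Definition outcome_is (X : sgraph) (o : outcome) : Prop :=
  match o with
  | OutcomeR => forall first, has_winning_strategy X Resolver first
  | OutcomeS => forall first, has_winning_strategy X Spoiler first
  | OutcomeN => forall first, has_winning_strategy X first first
  end.

(* The four numbers are given as relations "the number is k", because each is
   undefined (infinite) when the player concerned cannot win; the primed ones
   refer to the game in which Spoiler moves first. *)
Definition R_MB_is (X : sgraph) (k : nat) := min_moves X Resolver Resolver k.
Definition R_MB'_is (X : sgraph) (k : nat) := min_moves X Resolver Spoiler k.
Definition S_MB_is (X : sgraph) (k : nat) := min_moves X Spoiler Resolver k.
Definition S_MB'_is (X : sgraph) (k : nat) := min_moves X Spoiler Spoiler k.

(* Main.v *)
Require Import Defs.
From mathcomp Require Import all_boot.
Set Implicit Arguments.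
Unset Strict Implicit.
Unset Printing Implicit Defensive.

(** Twins are separated only by themselves, so a resolving set meets every pair
    of twins. In [G o K_2] each fibre over a vertex of [G] is a pair of true
    twins, so a resolving set has at least [n(G)] vertices.

    If [u], [v] are true twins of [G], the four vertices above them are pairwise
    true twins; Spoiler can take two of them with her first two moves, and a
    single vertex never suffices because the complement of a vertex is resolving.

    If [G] has no true twins, every set meeting all fibres is resolving, and
    Resolver wins by answering in the fibre in which Spoiler has just played:
    were both vertices of a fibre Spoiler's, the earlier of them would have been
    left unanswered. Each player makes exactly [n(G)] moves in total, so this is
    also the number of moves needed. *)

(** * Distances, true twins and resolving sets *)

Section Distance.
Variable X : sgraph.
Implicit Types x y z : X.

Lemma dist_le_walk x y (p : seq X) :
  path edge x p -> last x p = y -> size p < #|X| -> dist x y <= size p.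
Proof.
move=> xp px szp; rewrite leqNgt; apply/negP => /(before_find 0).
rewrite nth_iota // add0n => /negbT/negP; apply; apply/existsP.
by exists (in_tuple p); rewrite xp px eqxx.
Qed.

Lemma dist_walk x y :
  dist x y < #|X| ->
  exists p : seq X, [/\ path edge x p, last x p = y & size p = dist x y].
Proof.
move=> lt_d; have := lt_d; rewrite -[X in _ < X](size_iota 0) -has_find.
move=> /(nth_find 0); rewrite nth_iota // add0n => /existsP[p /andP[xp /eqP px]].
by exists p; rewrite size_tuple.
Qed.

Lemma distxx x : dist x x = 0.
Proof.
apply/eqP; rewrite -leqn0; apply: (@dist_le_walk _ _ [::]) => //=.
by rewrite (cardD1 x).
Qed.

Lemma dist_eq0 x y : dist x y = 0 -> x = y.
Proof.
move=> d0; have /dist_walk[p [_ px]] : dist x y < #|X| by rewrite d0 (cardD1 x).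
by rewrite d0 => /size0nil p0; rewrite -px p0.
Qed.

Lemma dist_le1 x y : 1 < #|X| -> (dist x y <= 1) = (x == y) || edge x y.
Proof.
move=> X_gt1; apply/idP/orP => [d1 | [/eqP -> | exy]]; last 2 first.
- by rewrite distxx.
- by apply: (@dist_le_walk _ _ [:: y]); rewrite /= ?exy.
have /dist_walk[p [xp px szp]] := leq_ltn_trans d1 X_gt1.
case: p xp px szp d1 => [|a [|b p]] /= => [_ -> | /andP[exa _] <- | _ _ <- //].
  by left.
by right.
Qed.

(** Pointwise form of true twins; distinctness is implied by irreflexivity of [edge]. *)
Definition twin_edge x y :=
  edge x y /\ forall z, z != x -> z != y -> edge x z = edge y z.

Lemma twin_edge_sym x y : twin_edge x y -> twin_edge y x.
Proof. by case=> exy H; split=> [|z zy zx]; rewrite ?H // edge_sym. Qed.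

(** A shortest walk from [x] to [z] can be restarted at [y]: its second vertex is either [y] itself,
    and the first step is dropped, or a common neighbour of [x] and [y]. *)
Lemma dist_twin_le x y z :
  twin_edge x y -> z != x -> z != y -> dist y z <= dist x z.
Proof.
(* If [dist x z] is the junk value, no walk is available, but [find] never exceeds the length of the
   list searched. *)
move=> [exy txy] zx zy; have [ge_d | lt_d] := leqP #|X| (dist x z).
  apply: leq_trans ge_d; rewrite -[X in _ <= X](size_iota 0); exact: find_size.
have [[|a p] [/= xp pz szp]] := dist_walk lt_d; first by rewrite pz eqxx in zx.
case/andP: xp => exa ap; rewrite -szp in lt_d *.
have [ay | ay] := eqVneq a y.
  by rewrite ltnW // ltnS; apply: dist_le_walk; rewrite -?ay // (ltn_trans _ lt_d).
apply: (@dist_le_walk _ _ (a :: p)) => //=; rewrite ap andbT -txy //.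
by apply: contraTneq exa => ->; rewrite edge_irr.
Qed.

Lemma dist_twin x y z :
  twin_edge x y -> z != x -> z != y -> dist x z = dist y z.
Proof.
move=> t zx zy; apply/eqP; rewrite eqn_leq.
by rewrite !dist_twin_le //; apply: twin_edge_sym.
Qed.

Lemma twin_edge_neq x y : twin_edge x y -> x <> y.
Proof. by move=> [exy _] e; rewrite e edge_irr in exy. Qed.

Lemma resolving_twin x y (R : {set X}) :
  twin_edge x y -> resolving R -> (x \in R) || (y \in R).
Proof.
move=> t /(_ x y (twin_edge_neq t))[z zR dz].
have [<- | zx] := eqVneq z x; first by rewrite zR.
have [<- | zy] := eqVneq z y; first by rewrite zR orbT.
by case: dz; apply: dist_twin.
Qed.

(** One of two distinct vertices differs from [w], and it separates itself from the other, being
    alone at distance 0 from itself. *)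
Lemma resolvingC1 (w : X) : resolving [set~ w].
Proof.
move=> x y xy; have [ex | xw] := eqVneq x w.
  exists y; first by rewrite !inE -ex eq_sym; apply/eqP.
  by rewrite distxx => /dist_eq0.
by exists x; rewrite ?inE // distxx => /esym/dist_eq0/esym.
Qed.

End Distance.

(** * Plays, preference strategies and Spoiler's wins *)

Section Play.
Variable X : sgraph.
Implicit Types (x : X) (h : seq X) (p first : player).

(** Makes statements about all plays following [s] non-vacuous, so that a single play yields lower
    bounds on the number of moves. The play is built by letting [s] choose the moves of both
    players. *)
Lemma complete_play_exists (s : strategy X) p first :
  legal s -> exists2 h, complete_play h & follows p first s h.
Proof.
move=> ls.
suff /(_ #|X| (leqnn _))[h [uh szh fh]] : forall n, n <= #|X| ->
    exists h, [/\ uniq h, size h = n & follows p first s h] by exists h.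
elim=> [_ | n IHn ltnX].
  by exists [::]; split=> // h1 x h2; case: h1.
have [h [uh szh fh]] := IHn (ltnW ltnX).
exists (rcons h (s h)); split; last first.
- move=> h1 x h2; case/lastP: h2 => [|h2 y].
    by rewrite cats1 => /rcons_inj[-> ->].
  by rewrite -rcons_cons -rcons_cat => /rcons_inj[eh _]; apply: fh eh.
- by rewrite size_rcons szh.
- by rewrite rcons_uniq uh ls // szh.
Qed.

Lemma mem_selected p first h x :
  uniq h ->
  (x \in selected p first h) = (x \in h) && (mover first (index x h) == p).
Proof.
move=> uh; rewrite /selected in_mask //; case xh: (x \in h) => //=.
by rewrite (nth_map 0) ?size_iota ?index_mem // nth_iota ?index_mem.
Qed.

(** Any two consecutive moves contain exactly one of each player, whoever starts. *)
Lemma size_selected p first h n :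
  size h = n.*2 -> size (selected p first h) = n.
Proof.
move=> szh; rewrite size_mask; last by rewrite size_map size_iota.
rewrite count_map {}szh; elim: n => // n IHn.
rewrite doubleS -addn2 iotaD count_cat {}IHn /= add0n /mover /= odd_double /=.
by case: p; case: first; rewrite /= addn1.
Qed.

Lemma wins_subset p (V W : {set X}) : V \subset W -> wins p V -> wins p W.
Proof.
case: p => VW /= => [[R rR RV] | winV R rR].
  by exists R => //; apply: subset_trans VW.
by have [x xR xV] := winV R rR; exists x => //; apply: (subsetP VW).
Qed.

Lemma can_win_winning p first k :
  can_win_within X p first k -> has_winning_strategy X p first.
Proof.
case=> s [ls win]; exists s; split=> // h ch fh.
by apply: wins_subset (win h ch fh); apply/subsetP=> x; rewrite !inE => /mem_take.
Qed.

(* [x0] is a junk value, returned only when no vertex is left. *)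
Definition prefer (x0 : X) (P : seq X -> pred X) : strategy X := fun h =>
  if [pick x | P h x & x \notin h] is Some x then x
  else odflt x0 [pick x | x \notin h].

Lemma prefer_legal x0 P : legal (prefer x0 P).
Proof.
move=> h uh szh; rewrite /prefer; case: pickP => [x /andP[] // | _].
case: pickP => [x //| /= full]; suff : #|X| <= size h by rewrite leqNgt szh.
rewrite -(card_uniqP uh); apply/subset_leq_card/subsetP => x _.
exact/negbNE/negbT/full.
Qed.

Lemma preferP x0 (P : seq X -> pred X) h x : P h x -> x \notin h -> P h (prefer x0 P h).
Proof.
move=> Px xh; rewrite /prefer; case: pickP => [y /andP[] // | /(_ x)].
by rewrite Px xh.
Qed.

Lemma follows_preferP x0 (P : seq X -> pred X) p first h1 x h2 y :
  follows p first (prefer x0 P) (h1 ++ x :: h2) ->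
  mover first (size h1) = p -> P h1 y -> y \notin h1 -> P h1 x.
Proof. by move=> fh mv Py yh; rewrite (fh _ _ _ erefl mv); apply: preferP yh. Qed.

Lemma spoiler_can_win_gt1 first k :
  can_win_within X Spoiler first k -> 1 < k.
Proof.
case=> s [ls win]; have [h ch fh] := complete_play_exists Spoiler first ls.
have := win h ch fh; rewrite ltnNge /= => {}win; apply/negP => k1.
have := size_take_min k (selected Spoiler first h).
case: (take k _) win => [|w [|w' t]] win sz.
- have [] := win [set: X] => [x y xy | x _]; last by rewrite !inE.
  by exists x; rewrite ?inE // distxx => /esym/dist_eq0/esym.
- by have [x] := win _ (@resolvingC1 _ w); rewrite !inE => /negbTE ->.
- have := leq_trans (geq_minl k (size (selected Spoiler first h))) k1.
  by rewrite -sz.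
Qed.

(** Spoiler's second move is at latest the fourth of the game, so at most three vertices are taken
    before it and [Q] still has a free one. *)
Lemma spoiler_wins_twin_clique (Q : {set X}) first :
  3 < #|Q| -> {in Q &, forall x y, x != y -> twin_edge x y} ->
  can_win_within X Spoiler first 2.
Proof.
move=> cQ tQ; have /card_gt0P[x0 _] : 0 < #|Q| by case: #|Q| cQ.
exists (prefer x0 (fun _ x => x \in Q)); split=> [|h [uh szh] fh].
  exact: prefer_legal.
have free (h' : seq X) : size h' < 4 -> exists2 y, y \in Q & y \notin h'.
  move=> sz; apply/subsetPn; apply: contraL sz => /subset_leq_card le_Q.
  by rewrite -leqNgt (leq_trans cQ) // (leq_trans le_Q) // card_size.
have inQ (h1 : seq X) x h2 : h = h1 ++ x :: h2 ->
    mover first (size h1) = Spoiler -> size h1 < 4 -> x \in Q.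
  move=> eh mv /free[y yQ yh]; rewrite eh in fh.
  exact: (follows_preferP fh mv yQ yh).
have win (x y : X) : x \in Q -> y \in Q -> x != y ->
    wins Spoiler [set z in [:: x; y]].
  move=> xQ yQ xy R /(resolving_twin (tQ _ _ xQ yQ xy)) /orP[xR | yR].
    by exists x; rewrite // !inE eqxx.
  by exists y; rewrite // !inE eqxx orbT.
have := leq_trans cQ (max_card _); rewrite -szh.
case: h uh fh inQ {szh} => [|a [|b [|c [|d t]]]] //= uh fh inQ _.
move: uh; rewrite !inE !negb_or -!andbA.
case/and5P=> ab ac ad at_ /and5P[bc bd bt cd _].
(* Her first two vertices are [b] and [d] if Resolver starts, [a] and [c] otherwise. *)
case: first fh inQ => fh inQ; rewrite /selected /= take0; apply: win => //.
- exact: (inQ [:: a] b [:: c, d & t]).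
- exact: (inQ [:: a; b; c] d t).
- exact: (inQ [::] a [:: b, c, d & t]).
- exact: (inQ [:: a; b] c (d :: t)).
Qed.

End Play.

(** * Resolver's pairing strategy *)

Section Pairing.
Variables (X : sgraph) (f : X -> X).
Hypothesis fK : involutive f.

Lemma resolver_wins_pairing first :
  0 < #|X| -> (forall x, f x != x) ->
  (forall W : {set X}, (forall x, (x \in W) || (f x \in W)) -> resolving W) ->
  exists2 s : strategy X, legal s &
    forall h, complete_play h -> follows Resolver first s h ->
      wins Resolver [set x in selected Resolver first h].
Proof.
move=> /card_gt0P[x0 _] f_neq res.
exists (prefer x0 (fun h x => x == f (last x0 h))); first exact: prefer_legal.
move=> h [uh szh] fh; set W := [set x in _]; exists W => //.
have hall x : x \in h.
  have card_h : #|h| = #|X| by rewrite (card_uniqP uh).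
  by have /(_ x) -> := subset_cardP card_h (subset_predT _).
apply: res => x; wlog lt_x : x / index x h < index (f x) h.
  move=> th; case: (ltngtP (index x h) (index (f x) h)) => [/th // | lt | e].
    by rewrite orbC -{2}[x]fK th // fK.
  by have /eqP[] := f_neq x; rewrite -[RHS](nth_index x0 (hall _)) e nth_index.
rewrite !inE !mem_selected // !hall /=.
case mvx: (mover first (index x h)) => //=.
have xh := hall x; case/splitPr: xh uh fh hall lt_x mvx => [h1 h2] uh fh hall lt_x mvx.
have xh1 : x \notin h1 by move: uh; rewrite cat_uniq /= => /and3P[_ /norP[]].
move: lt_x mvx; rewrite !index_cat (negbTE xh1) /= eqxx addn0.
case: ifP => [fxh1 | /negbT fxh1]; first by rewrite ltnNge ltnW // index_mem.
rewrite eq_sym (negbTE (f_neq x)) => _ mvx.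
(* Spoiler chose [x] while [f x] was free. The play goes on, as [f x] must still occur, and the next
   move [y] is Resolver's, hence [f x]. *)
case: h2 uh fh hall => [|y h2] uh fh hall.
  by have := hall (f x); rewrite mem_cat (negbTE fxh1) inE (negbTE (f_neq x)).
have mvy : mover first (size (rcons h1 x)) = Resolver.
  rewrite size_rcons; move: mvx; rewrite /mover /=.
  by case: odd; case: first {fh W}.
rewrite -cat_rcons in fh.
have := follows_preferP fh mvy (y := f x).
rewrite last_rcons eqxx mem_rcons inE negb_or f_neq fxh1 => /(_ isT isT)/eqP ->.
by rewrite /= eqxx addn1 -(size_rcons h1 x) mvy.
Qed.

End Pairing.

(** * The product with [K2]: fibres, resolving sets and numbers of moves *)

Section LexK2.
Variable G : sgraph.
Local Notation X := (lex_prod G K2).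

Definition flip (x : X) : X := (x.1, rev_ord x.2).

Lemma flipK : involutive flip.
Proof. by case=> g i; rewrite /flip /= rev_ordK. Qed.

Lemma rev_ord2_neq (i : 'I_2) : rev_ord i != i.
Proof. by case: i => [[|[|]]]. Qed.

Lemma ord2_neq (i j : 'I_2) : i != j -> j = rev_ord i.
Proof.
by case: i j => [[|[|]]] // ? [[|[|]]] // ? _; apply: val_inj.
Qed.

Lemma flip_neq x : flip x != x.
Proof. by case: x => g i; rewrite xpair_eqE eqxx rev_ord2_neq. Qed.

Lemma card_lexK2 : #|X| = #|G|.*2.
Proof. by rewrite card_prod card_ord muln2. Qed.

Lemma edge_lexK2 (x y : X) :
  edge x y = edge x.1 y.1 || (x.1 == y.1) && (x.2 != y.2).
Proof. by []. Qed.

Lemma twin_edge_lexK2 (x y : X) :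
  x != y -> x.1 = y.1 \/ true_twins x.1 y.1 -> twin_edge x y.
Proof.
case: x y => [g i] [h j] /= xy gh; split.
  rewrite edge_lexK2 /=; case: gh xy => [-> | [_ ->] //].
  by rewrite xpair_eqE eqxx => ->; rewrite orbT.
case=> k l; rewrite !xpair_eqE !edge_lexK2 /= (eq_sym g) (eq_sym h).
rewrite (eq_sym i) (eq_sym j).
have [<- | [[_ /setP tw] egh]] := gh.
  by have [-> /= -> -> | _] := eqVneq k g.
have := tw k; rewrite !inE; have [-> | kg] := eqVneq k g.
  by move=> _ /= ->; rewrite orbT edge_sym egh.
have [-> | kh] := eqVneq k h; first by rewrite egh => _ _ /= ->; rewrite orbT.
by rewrite /= !orbF.
Qed.

(** The first projection maps [R] onto [G]. *)
Lemma card_resolving_lexK2 (R : {set X}) : resolving R -> #|G| <= #|R|.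
Proof.
move=> rR; rewrite -cardsT; apply: leq_trans (leq_imset_card (fun x : X => x.1) _).
apply/subset_leq_card/subsetP => g _.
have t : @twin_edge X (g, ord0) (g, ord_max).
  by apply: twin_edge_lexK2; [rewrite xpair_eqE eqxx | left].
by case/orP: (resolving_twin t rR) => xR; apply/imsetP; [exists (g, ord0) | exists (g, ord_max)].
Qed.

Lemma resolving_lexK2 (W : {set X}) :
  1 < #|G| -> ~ has_true_twins G ->
  (forall x, (x \in W) || (flip x \in W)) -> resolving W.
Proof.
move=> G_gt1 notw W_flip.
have X_gt1 : 1 < #|X| by rewrite card_lexK2 (leq_trans G_gt1) // -addnn leq_addl.
have fibre g : exists2 z, z \in W & z.1 = g.
  have /orP[zW | zW] := W_flip (g, ord0).
    by exists (g, ord0).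
  by exists (flip (g, ord0)).
(* It is enough to compare closed neighbourhoods, that is, whether the distance to [z] is at most
   1. *)
have sep (x y z : X) :
    ((x == z) || edge x z) != ((y == z) || edge y z) ->
    dist x z <> dist y z.
  by move=> + exy; rewrite -!dist_le1 // exy eqxx.
move=> [g i] [h j] xy.
have [egh | gh] := eqVneq g h.
  rewrite -{}egh in xy *; have ij : i != j by apply: contra_not_neq xy => ->.
  have [zW | zW] := orP (W_flip (g, i)).
    by exists (g, i) => //; rewrite distxx => /esym/dist_eq0/esym.
  rewrite /flip /= -(ord2_neq ij) in zW.
  by exists (g, j) => //; rewrite distxx => /dist_eq0.
(* For [g], [h] non-adjacent, any vertex of [W] over [g] separates. For [g], [h] adjacent but not
   true twins, one over a vertex [k] adjacent to exactly one of them does; such a [k] differs from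
   both. *)
have [egh | negh] := boolP (edge g h); last first.
  have [[k l] zW /= ek] := fibre g; rewrite {}ek in zW.
  exists (g, l) => //; apply: sep.
  rewrite !edge_lexK2 !xpair_eqE /= eqxx (eq_sym h) (negbTE gh) (edge_sym h).
  by rewrite (negbTE negh) edge_irr /=; case: (i == l).
have [k ek] : exists k, (k \in nbh g :\ h) != (k \in nbh h :\ g).
  apply/existsP; rewrite -negb_forall; apply/negP => /forallP tw.
  apply: notw; exists g, h; split=> //; split; first exact/eqP.
  by apply/setP => k; apply/eqP/tw.
have [[k' l] zW /= ekk] := fibre k; rewrite {}ekk in zW.
exists (k, l) => //; apply: sep.
move: ek; rewrite !inE !edge_lexK2 !xpair_eqE /=.
have [-> | kg] := eqVneq k g; first by rewrite edge_irr !andbF.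
have [-> | kh] := eqVneq k h; first by rewrite edge_irr !andbF.
by rewrite /= !orbF.
Qed.

Lemma resolver_min_moves first :
  1 < #|G| -> ~ has_true_twins G -> min_moves X Resolver first #|G|.
Proof.
move=> G_gt1 notw; split=> [|j [s [ls win]]].
  have X_gt0 : 0 < #|X| by rewrite card_lexK2 double_gt0 ltnW.
  have [W|s ls win] := resolver_wins_pairing flipK first X_gt0 flip_neq.
    exact: resolving_lexK2.
  exists s; split=> // h ch fh; rewrite take_oversize; first exact: win.
  by rewrite (@size_selected _ _ _ _ #|G|) // ch.2 card_lexK2.
(* In one play, the first [j] vertices of Resolver already contain a resolving set, whose size
   bounds [j] from below. *)
have [h ch fh] := complete_play_exists Resolver first ls.
have [R /card_resolving_lexK2 cR sR] := win h ch fh.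
apply: leq_trans cR (leq_trans (subset_leq_card sR) _).
by rewrite cardsE (leq_trans (card_size _)) // size_take_min geq_minl.
Qed.

Lemma spoiler_min_moves first :
  has_true_twins G -> min_moves X Spoiler first 2.
Proof.
case=> u [v tuv]; split; last exact: spoiler_can_win_gt1.
have tvu : true_twins v u.
  by case: tuv => -[uv e] euv; split; [split=> // /esym | rewrite edge_sym].
apply: (@spoiler_wins_twin_clique X (setX [set u; v] [set: K2])).
  by rewrite cardsX cards2 cardsT card_ord; case: eqP tuv.1.1.
move=> x y; rewrite !inE !andbT => xQ yQ xy; apply: twin_edge_lexK2 => //.
by case/orP: xQ => /eqP ->; case/orP: yQ => /eqP ->; auto.
Qed.

End LexK2.

(** Decided by a finite search; this provides the case split behind the outcome. *)
Lemma has_true_twins_dec (G : sgraph) : has_true_twins G \/ ~ has_true_twins G.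
Proof.
pose tw (u v : G) := [&& u != v, nbh u :\ v == nbh v :\ u & edge u v].
have twP u v : reflect (true_twins u v) (tw u v).
  apply: (iffP and3P) => [[/eqP uv /eqP e euv] | [[/eqP uv /eqP e] euv]] //.
have [/existsP[u /existsP[v /twP t]] | no] :=
  boolP [exists u, exists v, tw u v].
  by left; exists u, v.
right=> -[u [v /twP t]]; case/negP: no; apply/existsP; exists u.
by apply/existsP; exists v.
Qed.

Theorem theorem4p2 (G : sgraph) (Gconn : connected G) (Gcard : 2 <= #|G|) :
  (outcome_is (lex_prod G K2) OutcomeR \/ outcome_is (lex_prod G K2) OutcomeS) /\
  (has_true_twins G ->
     S_MB_is (lex_prod G K2) 2 /\ S_MB'_is (lex_prod G K2) 2) /\
  (~ has_true_twins G ->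
     R_MB_is (lex_prod G K2) #|G| /\ R_MB'_is (lex_prod G K2) #|G|).
Proof.
split; last first.
  by split=> ?; split; (exact: spoiler_min_moves || exact: resolver_min_moves).
have [tw | notw] := has_true_twins_dec G; [right | left] => first.
  exact: can_win_winning (spoiler_min_moves first tw).1.
exact: can_win_winning (resolver_min_moves first Gcard notw).1.
Qed.
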